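(* Let $X,Y$ be separable real sequence spaces with normalized 1-unconditional bases $\{e_i\}_{i=1}^d$ and $\{f_i\}_{i=1}^d$, respectively ($d\le\infty$), and suppose that for at least one of the spaces $X$, $Y$ all surjective isometries of that space onto itself are elementary. Assume additionally that one of the spaces $X$, $Y$ has no 2-dimensional subspace isometric to $\ell_2^2$, and that either both $X$ and $Y$ are one-2-convex or both $X$ and $Y$ are one-2-concave. Then every surjective isometry $T:X\to Y$ is elementary.
   Context: All spaces are real and isometries are linear. A sequence space is a Banach space with a 1-unconditional basis $\{e_i\}_{i=1}^d$ ($d\le\infty$; if $d=\infty$ the index set is $\mathbb{N}$): a (Schauder) basis such that $\|\sum_i\varepsilon_i a_ie_i\|=\|\sum_i a_ie_i\|$ for all $\sum_i a_ie_i$ in the space and all signs $\varepsilon_i=\pm1$. Normalized means all basis vectors have norm one. Absolute values and powers are taken coordinatewise. An operator $T:X\to Y$ between sequence spaces with 1-unconditional bases $\{e_i\}_{i=1}^d$ and $\{f_i\}_{i=1}^d$ is elementary if there are $a_i\in\mathbb{R}$ and a permutation $\sigma$ of $\{1,\dots,d\}$ with $T(e_i)=a_if_{\sigma(i)}$ for all $i$. $X$ is one-2-convex if for every finite choice $x_1,\dots,x_m\in X$, $\|(\sum_{i=1}^m|x_i|^2)^{1/2}\|\le(\sum_{i=1}^m\|x_i\|^2)^{1/2}$, and one-2-concave if for every such choice $\|(\sum_{i=1}^m|x_i|^2)^{1/2}\|\ge(\sum_{i=1}^m\|x_i\|^2)^{1/2}$. $\ell_2^2$ is $\mathbb{R}^2$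 with the Euclidean norm. *)

(* Defs.v *)
From HB Require Import structures.
From mathcomp Require Import all_boot all_order all_algebra.
From mathcomp Require Import all_classical all_reals all_analysis.
Set Implicit Arguments.
Unset Strict Implicit.
Unset Printing Implicit Defensive.
Import Order.TTheory GRing.Theory Num.Theory.
Import numFieldNormedType.Exports.
Local Open Scope classical_set_scope.
Local Open Scope ring_scope.

(* A dimension d <= oo is an [option nat], [None] standing for oo, and the
   indices are numbered from 0.  A family indexed by [index_set d] is a function
   on [nat] whose values outside [index_set d] are never used. *)
Definition index_set (d : option nat) : set nat :=
  if d is Some n then `I_n else [set: nat].

Definition separable (T : topologicalType) : Prop :=
  exists2 S : set T, countable S & dense S.

Section SequenceSpaces.
Context {R : realType}.
Implicit Types (X Y : completeNormedModType R) (d : option nat).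

(* For d = Some k the partial sums are constant from rank k on, so that
   convergence reduces to a finite sum. *)
Definition partial_sums X d (e : nat -> X) (a : nat -> R) : nat -> X :=
  fun n => \sum_(0 <= i < n | i \in index_set d) a i *: e i.

Definition expansion X d (e : nat -> X) (a : nat -> R) (x : X) : Prop :=
  partial_sums d e a @ \oo --> x.

Definition schauder_basis X d (e : nat -> X) : Prop :=
  forall x : X, exists2 a : nat -> R, expansion d e a x &
    forall b : nat -> R, expansion d e b x -> {in index_set d, b =1 a}.

Definition one_unconditional X d (e : nat -> X) : Prop :=
  forall (a : nat -> R) (x : X) (eps : nat -> bool), expansion d e a x ->
    exists2 y : X, expansion d e (fun i => (-1) ^+ eps i * a i) y & `|y| = `|x|.

Definition normalized X d (e : nat -> X) : Prop :=
  {in index_set d, forall i, `|e i| = 1}.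

Definition normalized_1unconditional_basis X d (e : nat -> X) : Prop :=
  [/\ schauder_basis d e, one_unconditional d e & normalized d e].

(* When e is a Schauder basis, the value at i \in index_set d is the i-th
   coordinate of x. *)
Definition coord X d (e : nat -> X) (x : X) : nat -> R :=
  xget (fun=> 0) [set a | expansion d e a x].

(* (sum_k |x_k|^2)^(1/2), computed coordinatewise.  The limit exists when e is a
   1-unconditional Schauder basis of X: the coordinates are dominated by those of
   sum_k |x_k|, which lies in X, and X is complete. *)
Definition square_function X d (e : nat -> X) m (x : 'I_m -> X) : X :=
  limn (partial_sums d e
    (fun i => Num.sqrt (\sum_(k < m) `|coord d e (x k) i| ^+ 2))).

Definition one_2_convex X d (e : nat -> X) : Prop :=
  forall m (x : 'I_m -> X),
    `|square_function d e x| <= Num.sqrt (\sum_(k < m) `|x k| ^+ 2).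

Definition one_2_concave X d (e : nat -> X) : Prop :=
  forall m (x : 'I_m -> X),
    `|square_function d e x| >= Num.sqrt (\sum_(k < m) `|x k| ^+ 2).

Definition elementary X Y d (e : nat -> X) (f : nat -> Y) (T : X -> Y) : Prop :=
  exists (a : nat -> R) (sigma : nat -> nat),
    set_bij (index_set d) (index_set d) sigma /\
    {in index_set d, forall i, T (e i) = a i *: f (sigma i)}.

Definition surjective_isometry X Y (T : X -> Y) : Prop :=
  (forall x, `|T x| = `|x|) /\ range T = [set: Y].

Definition isometries_elementary X d (e : nat -> X) : Prop :=
  forall T : {linear X -> X}, surjective_isometry T -> elementary d e e T.

Definition subspace_2dim X (V : set X) : Prop :=
  exists u v : X,
    (forall s t : R, s *: u + t *: v = 0 -> s = 0 /\ t = 0) /\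
    V = [set w | exists s t : R, w = s *: u + t *: v].

(* The norm that MathComp-Analysis puts on 'rV[R]_2 is the sup norm, hence the
   explicit Euclidean norm. *)
Definition isometric_to_l22 X (V : set X) : Prop :=
  exists J : {linear 'rV[R]_2 -> X},
    (forall z, `|J z| = Num.sqrt (\sum_(i < 2) z 0 i ^+ 2)) /\ range J = V.

Definition no_l22_subspace X : Prop :=
  ~ exists V : set X, subspace_2dim V /\ isometric_to_l22 V.

End SequenceSpaces.

(* Main.v *)
Require Import Defs.
From HB Require Import structures.
From mathcomp Require Import all_boot all_order all_algebra.
From mathcomp Require Import all_classical all_reals all_analysis.
From mathcomp Require Import ring lra.
Set Implicit Arguments.
Unset Strict Implicit.
Unset Printing Implicit Defensive.
Import Order.TTheory GRing.Theory Num.Theory.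
Import numFieldNormedType.Exports.
Local Open Scope classical_set_scope.
Local Open Scope ring_scope.

(* Say that all isometries of X are elementary, and put y_j = T^-1 f_j, with dual
   functionals g_j = f_j^* o T.  The isometry x |-> x - 2 g_j(x) y_j of X, conjugate
   to the sign change of f_j, permutes the e_i up to signs, and
   being a reflection it either changes the sign of one e_i or exchanges e_i and
   a e_k with a = +-1.  So y_j is proportional to e_i or to e_i - a e_k.  In the
   second case some y_l is proportional to e_i + a e_k, since otherwise all the
   coordinates of T (e_i + a e_k) would vanish; comparing norms then gives
   |e_i + e_k| |f_j + f_l| = 2.  Under 2-convexity both factors are at most
   sqrt 2 (at least, under 2-concavity), so |e_i + e_k| = sqrt 2, which forces the
   norm to be Euclidean on the span of e_i and e_k.  The hypothesis on l_2^2 excludes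
   this, so only the first case occurs. *)

(* [vector.coord] shadows it. *)
Local Notation coord := Defs.coord.

(** * Expansions, coordinates, and sign changes on coordinate planes *)

Section Expansion.
Context {R : realType} {X : completeNormedModType R} {d : option nat}.
Context {e : nat -> X}.
Local Notation D := (index_set d).

Lemma expansion_unique a x y : expansion d e a x -> expansion d e a y -> x = y.
Proof. by move=> ax ay; apply: (cvg_unique _ ax ay). Qed.

Lemma expansion_ext a b x : {in D, a =1 b} -> expansion d e a x ->
  expansion d e b x.
Proof.
move=> ab; rewrite /expansion; suff -> : partial_sums d e a = partial_sums d e b by [].
by apply/funext => n; apply: eq_bigr => i iD; rewrite ab.
Qed.

Lemma expansion_linear (s : R) a b x y : expansion d e a x -> expansion d e b y ->
  expansion d e (fun i => s * a i + b i) (s *: x + y).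
Proof.
move=> ax b_y; rewrite /expansion.
suff -> : partial_sums d e (fun i => s * a i + b i) =
    (fun n => s *: partial_sums d e a n + partial_sums d e b n).
  by apply: cvgD => //; apply: cvgZl_tmp.
apply/funext => n; rewrite /partial_sums scaler_sumr -big_split /=.
by apply: eq_bigr => i _; rewrite scalerDl scalerA.
Qed.

Lemma expansion0 : expansion d e (fun=> 0) 0.
Proof.
rewrite /expansion; suff -> : partial_sums d e (fun=> 0) = (fun=> 0) by exact: cvg_cst.
by apply/funext => n; apply: big1 => i _; rewrite scale0r.
Qed.

Lemma expansion_basis i : i \in D -> expansion d e (fun m => (m == i)%:R) (e i).
Proof.
move=> iD; apply: cvg_near_cst; exists i.+1 => // n /= ltin.
rewrite /partial_sums big_mkcond /= (bigD1_seq i) ?mem_index_iota ?iota_uniq //=.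
rewrite iD eqxx scale1r big1 ?addr0 // => m /negPf ->.
by rewrite scale0r if_same.
Qed.

Lemma expansion2 i k (a b : R) : i \in D -> k \in D ->
  expansion d e (fun m => a * (m == i)%:R + b * (m == k)%:R) (a *: e i + b *: e k).
Proof.
move=> iD kD.
apply: expansion_linear; first exact: expansion_basis.
rewrite -[b *: e k]addr0; have := expansion_linear (s := b) (expansion_basis kD) expansion0.
by apply: expansion_ext => m _; rewrite addr0.
Qed.

Context (sb : schauder_basis d e).

Lemma expansion_coord x : expansion d e (coord d e x) x.
Proof. by rewrite /coord; case: xgetP => //= H; have [a ax _] := sb x; case: (H a). Qed.

Lemma coordE a x : expansion d e a x -> {in D, coord d e x =1 a}.
Proof.
move=> ax i iD; have [b bx bu] := sb x.
by rewrite (bu _ ax) // (bu _ (expansion_coord (x := x))).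
Qed.

Lemma coordP i (s : R) x y : i \in D ->
  coord d e (s *: x + y) i = s * coord d e x i + coord d e y i.
Proof.
by move=> iD; rewrite (coordE (expansion_linear (s := s) (expansion_coord (x := x)) (expansion_coord (x := y)))).
Qed.

Lemma coordZ i (s : R) x : i \in D -> coord d e (s *: x) i = s * coord d e x i.
Proof.
by move=> iD; rewrite -[s *: x]addr0 coordP // (coordE expansion0) // addr0.
Qed.

Lemma coord_basis i k : i \in D -> k \in D -> coord d e (e i) k = (k == i)%:R.
Proof. by move=> iD kD; rewrite (coordE (expansion_basis iD)). Qed.

Lemma coord2 i k m (a b : R) : i \in D -> k \in D -> m \in D ->
  coord d e (a *: e i + b *: e k) m = a * (m == i)%:R + b * (m == k)%:R.
Proof. by move=> iD kD mD; rewrite (coordE (expansion2 (a := a) (b := b) iD kD)). Qed.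

Lemma coord_neq0 x : x != 0 -> exists2 i, i \in D & coord d e x i != 0.
Proof.
move=> x0; apply: contrapT => nex; case/eqP: x0.
apply: (expansion_unique (a := fun=> 0)); last exact: expansion0.
apply: expansion_ext (expansion_coord (x := x)) => i iD; apply: contrapT => /eqP ci.
by apply: nex; exists i.
Qed.

(** The convexity hypotheses are only ever applied to two vectors of one coordinate plane. There the
    square function has finite support, so its limit is explicit. *)
Lemma square_function2 i k (x y : X) (a b a' b' : R) :
    i \in D -> k \in D -> i != k ->
    x = a *: e i + b *: e k -> y = a' *: e i + b' *: e k ->
  square_function d e (fun m : 'I_2 => if m == ord0 then x else y) =
  Num.sqrt (a ^+ 2 + a' ^+ 2) *: e i + Num.sqrt (b ^+ 2 + b' ^+ 2) *: e k.
Proof.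
move=> iD kD ik -> ->; apply: cvg_lim => //; rewrite -/(expansion _ _ _ _).
apply: expansion_ext (expansion2 iD kD) => m mD.
rewrite !big_ord_recl big_ord0 addr0 /= !coord2 // !real_normK ?num_real //.
have [-> | mi] := eqVneq m i.
  by rewrite (negPf ik) !mulr1 !mulr0 !addr0.
have [_|mk] := eqVneq m k; first by rewrite !mulr1 !mulr0 !add0r.
by rewrite !mulr0 !addr0 expr0n /= addr0 sqrtr0.
Qed.

Context (uncond : one_unconditional d e).

Lemma norm_sign2 i k (a b : R) (p q : bool) : i \in D -> k \in D -> i != k ->
  `|((-1) ^+ p * a) *: e i + ((-1) ^+ q * b) *: e k| = `|a *: e i + b *: e k|.
Proof.
move=> iD kD ik.
have [y yE <-] := uncond (fun m => if m == i then p else q) (expansion2 (a := a) (b := b) iD kD).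
congr (`| _ |); apply: expansion_unique yE.
apply: expansion_ext (expansion2 iD kD) => m mD.
have [-> | mi] := eqVneq m i; first by rewrite (negPf ik) !mulr0 !mulr1 !addr0.
by rewrite !mulr0 !add0r mulrA.
Qed.

Lemma norm_abs2 i k (a b : R) : i \in D -> k \in D -> i != k ->
  `| `|a| *: e i + `|b| *: e k| = `|a *: e i + b *: e k|.
Proof.
by move=> iD kD ik; rewrite !normrEsign norm_sign2.
Qed.

(** The vector on the left is [x] with the sign of its [j]-th coordinate reversed. *)
Lemma norm_reflection j x : j \in D -> `|x - (2 * coord d e x j) *: e j| = `|x|.
Proof.
move=> jD; have [y yE <-] := uncond (fun m => m == j) (expansion_coord (x := x)).
congr (`| _ |); apply: expansion_unique yE.
have := expansion_linear (s := - (2 * coord d e x j)) (expansion_basis jD) (expansion_coord (x := x)).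
rewrite scaleNr addrC; apply: expansion_ext => m mD.
by have [-> | mj] := eqVneq m j; rewrite /= ?expr1 ?expr0; ring.
Qed.

(* [s = 1] encodes 2-convexity and [s = -1] 2-concavity. *)
Definition two_convexity_sign (s : R) : Prop := forall i k (a b a' b' : R),
  i \in D -> k \in D -> i != k ->
  0 <= s * (`|a *: e i + b *: e k| ^+ 2 + `|a' *: e i + b' *: e k| ^+ 2
     - `|Num.sqrt (a ^+ 2 + a' ^+ 2) *: e i + Num.sqrt (b ^+ 2 + b' ^+ 2) *: e k| ^+ 2).

Lemma convex_sign : one_2_convex d e -> two_convexity_sign 1.
Proof.
move=> cvx i k a b a' b' iD kD ik.
rewrite mul1r subr_ge0 -(@square_function2 _ _ _ _ _ _ _ _ iD kD ik erefl erefl).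
set F := fun _ => _; have := cvx 2%N F.
rewrite !big_ord_recl big_ord0 addr0 /= => /(lerXn2r 2).
by rewrite sqr_sqrtr ?addr_ge0 ?sqr_ge0 //; apply; rewrite nnegrE ?sqrtr_ge0.
Qed.

Lemma concave_sign : one_2_concave d e -> two_convexity_sign (-1).
Proof.
move=> cve i k a b a' b' iD kD ik.
rewrite mulN1r opprB subr_ge0 -(@square_function2 _ _ _ _ _ _ _ _ iD kD ik erefl erefl).
set F := fun _ => _; have := cve 2%N F.
rewrite !big_ord_recl big_ord0 addr0 /= => /(lerXn2r 2).
by rewrite sqr_sqrtr ?addr_ge0 ?sqr_ge0 //; apply; rewrite nnegrE ?sqrtr_ge0.
Qed.

(** * Comparison of coordinate planes with the Euclidean plane *)

Context (norm1 : normalized d e).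
Context (s : R).
Context (cs : two_convexity_sign s).

Lemma sign_euclid_le i k (a b : R) : i \in D -> k \in D -> i != k ->
  0 <= s * (a ^+ 2 + b ^+ 2 - `|a *: e i + b *: e k| ^+ 2).
Proof.
(* The vectors [a *: e i] and [b *: e k] have disjoint supports, so up to signs their square
   function is their sum. *)
move=> iD kD ik; have := cs a 0 0 b iD kD ik.
rewrite !expr0n /= !addr0 !add0r !sqrtr_sqr norm_abs2 // !scale0r addr0 add0r.
by rewrite !normrZ !norm1 // !mulr1 !real_normK ?num_real.
Qed.

(* Completing the smaller coordinate of [(a, b)] to the larger one turns the
   square function into a multiple of [e i + e k]. *)
Lemma sign_euclid_ge i k (a b : R) : i \in D -> k \in D -> i != k ->
  `|e i + e k| ^+ 2 = 2 -> `|b| <= `|a| ->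
  0 <= s * (`|a *: e i + b *: e k| ^+ 2 - (a ^+ 2 + b ^+ 2)).
Proof.
move=> iD kD ik N2 ba.
have ba2 : b ^+ 2 <= a ^+ 2.
  rewrite -[b ^+ 2]real_normK ?num_real // -[a ^+ 2]real_normK ?num_real //.
  by rewrite lerXn2r ?nnegrE.
have := cs a b 0 (Num.sqrt (a ^+ 2 - b ^+ 2)) iD kD ik.
rewrite sqr_sqrtr ?subr_ge0 // expr0n /= addr0 (addrC (b ^+ 2)) subrK !sqrtr_sqr.
rewrite -scalerDr !normrZ normr_id exprMn N2 scale0r add0r normrZ norm1 // mulr1.
rewrite !real_normK ?num_real // sqr_sqrtr ?subr_ge0 //.
suff -> : forall p a b : R, p + (a - b) - a * 2 = p - (a + b) by [].
by move=> *; ring.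
Qed.

(** The two preceding bounds are opposite inequalities once multiplied by [s]. When the second
    coordinate is the larger one, [i] and [k] are exchanged. *)
Lemma euclid i k (a b : R) : s != 0 -> i \in D -> k \in D -> i != k ->
  `|e i + e k| ^+ 2 = 2 -> `|a *: e i + b *: e k| = Num.sqrt (a ^+ 2 + b ^+ 2).
Proof.
move=> s0 iD kD ik N2; rewrite -[LHS]normr_id -sqrtr_sqr; congr Num.sqrt.
have le := sign_euclid_le a b iD kD ik.
have ge : 0 <= s * (`|a *: e i + b *: e k| ^+ 2 - (a ^+ 2 + b ^+ 2)).
  have [ba|/ltW ab] := leP `|b| `|a|; first exact: sign_euclid_ge.
  rewrite (addrC (a *: _)) (addrC (a ^+ 2)).
  by apply: sign_euclid_ge; rewrite // 1?eq_sym // addrC.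
apply: (mulfI s0); apply/eqP; rewrite eq_le.
by rewrite -subr_ge0 -mulrBr le -subr_ge0 -mulrBr ge.
Qed.

End Expansion.

(** * Linear isometries, their inverses, and Euclidean planes *)

Section Isometries.
Context {R : realType}.
Implicit Types X Y : completeNormedModType R.

Lemma isometry_inj X Y (T : {linear X -> Y}) : (forall x, `|T x| = `|x|) -> injective T.
Proof.
move=> isoT x y Txy; apply/eqP; rewrite -subr_eq0 -normr_eq0 -isoT.
by rewrite linearB Txy subrr normr0.
Qed.

Lemma isometry_expansion X Y d (e : nat -> X) (T : {linear X -> Y}) a x :
  (forall x, `|T x| = `|x|) -> expansion d e a x -> expansion d (T \o e) a (T x).
Proof.
move=> isoT ax; rewrite /expansion.
have -> : partial_sums d (T \o e) a = (fun n => T (partial_sums d e a n)).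
  apply/funext => n; rewrite linear_sum; apply: eq_bigr => i _.
  by rewrite linearZ.
apply/cvgrPdist_lt => r r0; have /cvgrPdist_lt/(_ r r0) := ax.
by apply: filterS => n; rewrite -linearB isoT.
Qed.

Lemma linear_ext (V W : lmodType R) (g : V -> W) :
  linear g -> exists T : {linear V -> W}, T =1 g.
Proof.
move=> lg; pose T : {linear V -> W} := HB.pack g (GRing.isLinear.Build R V W *:%R g lg).
by exists T.
Qed.

Lemma surjective_isometry_inverse X Y (T : {linear X -> Y}) : surjective_isometry T ->
  exists S : {linear Y -> X}, [/\ surjective_isometry S, cancel S T & cancel T S].
Proof.
move=> [isoT surT]; have injT := isometry_inj isoT.
have ex y : exists x, T x = y.
  by have [x _ <-] : range T y by [rewrite surT]; exists x.
pose g y := sval (cid (ex y)).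
have gK : cancel g T by move=> y; rewrite /g; case: cid.
have lg : linear g by move=> a x y; apply: injT; rewrite linearP !gK.
have [S Sg] := linear_ext lg; exists S.
have SK : cancel S T by move=> y; rewrite Sg gK.
have TK : cancel T S by move=> x; apply: injT; rewrite SK.
split=> //; split=> [x|]; first by rewrite -isoT SK.
by rewrite eqEsubset; split=> // x _; exists (T x); rewrite ?TK.
Qed.

Lemma elementary_inverse X Y d (e : nat -> X) (f : nat -> Y)
    (T : {linear X -> Y}) (S : {linear Y -> X}) :
  (forall i, i \in index_set d -> e i != 0) -> cancel T S ->
  elementary d e f T -> elementary d f e S.
Proof.
move=> e0 TK [a [sigma [[sD sI sS] Te]]].
(* The inverse permutation is chosen pointwise, with default value 0 outside the index set. *)
have ex j : exists i, j \in index_set d -> i \in index_set d /\ sigma i = j.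
  have [/set_mem/sS[i iD <-]|_] := boolP (j \in index_set d); last by exists 0%N.
  by exists i => _; rewrite inE.
pose tau j := sval (cid (ex j)).
have tauP j : j \in index_set d -> tau j \in index_set d /\ sigma (tau j) = j.
  by rewrite /tau; case: cid.
exists (fun j => (a (tau j))^-1), tau; split; first split.
- by move=> j /mem_set/tauP[/set_mem].
- by move=> j k /tauP[_ sj] /tauP[_ sk] tjk; rewrite -sj tjk.
- move=> i iD; exists (sigma i); first exact: sD.
  have [tD st] := tauP _ (mem_set (sD _ iD)).
  by apply: sI; rewrite // inE.
move=> j /tauP[tD st]; rewrite -{1}st.
have := Te _ tD; have := e0 _ tD; set i := tau j; set c := a i => ei0 Tei.
(* A zero coefficient would give T e_i = 0, hence e_i = 0 by cancellation. *)
have c0 : c != 0.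
  apply: contra_neq ei0 => c0; move: Tei; rewrite c0 scale0r => Tei.
  by rewrite -(TK (e i)) Tei linear0.
by rewrite -(TK (e i)) Tei linearZ scalerA mulVf ?scale1r.
Qed.

Lemma euclid_plane_l22 X (u v : X) :
  (forall a b : R, `|a *: u + b *: v| = Num.sqrt (a ^+ 2 + b ^+ 2)) ->
  ~ no_l22_subspace X.
Proof.
move=> uv; apply.
exists [set w | exists s t : R, w = s *: u + t *: v]; split.
  exists u, v; split=> // s t st0.
  have := uv s t; rewrite st0 normr0 => /esym/eqP.
  rewrite sqrtr_eq0 => le0; have := sqr_ge0 s; have := sqr_ge0 t => t0 s0.
  by split; apply/eqP; rewrite -sqrf_eq0 eq_le ?s0 ?t0 andbT; lra.
have [|J JE] := @linear_ext 'rV[R]_2 X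
    (fun z => z 0 ord0 *: u + z 0 (lift ord0 ord0) *: v).
  move=> a y z; rewrite !mxE !scalerDl !scalerDr !scalerA.
  by rewrite addrACA.
exists J; split=> [z|]; first by rewrite JE uv !big_ord_recl big_ord0 addr0.
apply/seteqP; split=> [w [z _ <-]|w [a [b ->]]].
  by rewrite JE; exists (z 0 ord0), (z 0 (lift ord0 ord0)).
by exists (\row_i if i == ord0 then a else b) => //; rewrite JE !mxE.
Qed.

End Isometries.

(** * Reflections of X conjugate to the sign changes of the basis of Y *)

Section Reflections.
Context {R : realType} {X Y : completeNormedModType R} {d : option nat}.
Context {e : nat -> X} {f : nat -> Y}.
Context (basis_e : normalized_1unconditional_basis d e).
Context (basis_f : normalized_1unconditional_basis d f).
Context (elem : isometries_elementary d e).
Context {T : {linear X -> Y}} {S : {linear Y -> X}}.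
Context (isoT : forall x, `|T x| = `|x|) (SK : cancel S T) (TK : cancel T S).
Local Notation D := (index_set d).
Local Notation g j x := (coord d f (T x) j).

Let sbe : schauder_basis d e. Proof. by case: basis_e. Qed.
Let sbf : schauder_basis d f. Proof. by case: basis_f. Qed.
Let uce : one_unconditional d e. Proof. by case: basis_e. Qed.
Let ucf : one_unconditional d f. Proof. by case: basis_f. Qed.
Let ne : normalized d e. Proof. by case: basis_e. Qed.
Let nf : normalized d f. Proof. by case: basis_f. Qed.

Let isoS y : `|S y| = `|y|. Proof. by rewrite -isoT SK. Qed.

Let gP j (s : R) x y : j \in D -> g j (s *: x + y) = s * g j x + g j y.
Proof. by move=> jD; rewrite linearP coordP. Qed.

Let gZ j (s : R) x : j \in D -> g j (s *: x) = s * g j x.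
Proof. by move=> jD; rewrite linearZ coordZ. Qed.

Let gD j (s : R) x y : j \in D -> g j (x + s *: y) = g j x + s * g j y.
Proof. by move=> jD; rewrite addrC gP // addrC. Qed.

Let gS j l : j \in D -> l \in D -> g j (S (f l)) = (j == l)%:R.
Proof. by move=> jD lD; rewrite SK coord_basis. Qed.

(** [T] carries this map to the reversal of the [j]-th coordinate in Y, which preserves the norm. *)
Lemma conjugate_reflection j : j \in D -> exists2 U : {linear X -> X},
  surjective_isometry U & U =1 fun x => x - (2 * g j x) *: S (f j).
Proof.
move=> jD.
have [|U UE] := @linear_ext _ X X (fun x => x - (2 * g j x) *: S (f j)).
  move=> a x y; rewrite gP // scalerBr scalerA addrACA -opprD -scalerDl.
  by congr (_ - _ *: _); ring.
exists U => //; split=> [x|].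
  by rewrite -isoT UE linearB linearZ /= SK norm_reflection.
(* [U] is an involution because [g j] takes the value 1 at [S (f j)], so [U x] is a preimage of
   [x]. *)
apply/seteqP; split=> // x _; exists (U x) => //.
have {}UE z : U z = z + (- (2 * g j z)) *: S (f j) by rewrite UE scaleNr.
rewrite !UE gD // gS // eqxx mulr1 -addrA -scalerDl.
by rewrite [X in X *: _](_ : _ = 0) ?scale0r ?addr0 //; ring.
Qed.

(** Solve U e_i = e_i - 2 g_j(e_i) y_j for y_j, where U e_i = a e_k because [U] is elementary. The
    case [k = i] is allowed and is the one that survives in the end. *)
Lemma preimage_basis_shape i j : i \in D -> j \in D -> g j (e i) != 0 ->
  exists k (a : R), [/\ k \in D, `|a| = 1 &
    S (f j) = (2 * g j (e i))^-1 *: (e i - a *: e k)].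
Proof.
move=> iD jD gji; have [U Uiso UE] := conjugate_reflection jD.
have [a [sigma [[sD _ _] Ue]]] := elem Uiso.
have kD : sigma i \in D by rewrite inE; apply: sD; rewrite -inE.
exists (sigma i), (a i); split=> //.
  by have := Uiso.1 (e i); rewrite Ue // normrZ !ne // mulr1.
rewrite -Ue // UE opprB addrC subrK scalerA mulVf ?scale1r //.
by rewrite mulf_neq0 // pnatr_eq0.
Qed.

(** Otherwise [U] fixes every e_i, hence by continuity every vector, whereas it sends y_j to -y_j
    and y_j has norm 1. *)
Lemma preimage_basis_support j : j \in D -> exists2 i, i \in D & g j (e i) != 0.
Proof.
move=> jD; apply: contrapT => nex.
have [U [isoU _] UE] := conjugate_reflection jD.
have Ue i : i \in D -> U (e i) = e i.
  move=> iD; rewrite UE; suff -> : g j (e i) = 0 by rewrite mulr0 scale0r subr0.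
  by apply: contrapT => /eqP gji; apply: nex; exists i.
have ay := expansion_coord sbe (x := S (f j)).
have UyE : U (S (f j)) = S (f j).
  have := isometry_expansion isoU ay; rewrite /expansion.
  have -> : partial_sums d (U \o e) = partial_sums d e.
    apply/funext => a; apply/funext => n; apply: eq_bigr => i iD /=.
    by rewrite Ue.
  by move=> H; apply: expansion_unique H ay.
have : `|(2 : R) *: S (f j)| = 0.
  move: UyE; rewrite UE gS // eqxx mulr1 => /eqP.
  by rewrite addrC -subr_eq0 addrK oppr_eq0 => /eqP ->; rewrite normr0.
by rewrite normrZ isoS nf // mulr1 => /eqP; rewrite normr_eq0 pnatr_eq0.
Qed.

Lemma preimage_basis_partner i j k (a : R) :
  i \in D -> j \in D -> k \in D -> g j (e i) != 0 -> k != i -> `|a| = 1 ->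
  S (f j) = (2 * g j (e i))^-1 *: (e i - a *: e k) ->
  exists l (c : R), [/\ l \in D, l != j & S (f l) = c *: (e i + a *: e k)].
Proof.
move=> iD jD kD gji ki a1 yj.
have w0 : T (e i + a *: e k) != 0.
  apply/eqP => Tw; have : e i + a *: e k = 0 by rewrite -[LHS]TK Tw linear0.
  rewrite -[e i]scale1r => /(congr1 (fun x => coord d e x i)).
  rewrite coord2 // (coordE sbe expansion0) // eqxx eq_sym (negPf ki).
  by rewrite mulr0 addr0 mulr1 => /eqP; rewrite oner_eq0.
(* The partner [l] is any index at which T (e_i + a e_k) has a nonzero coordinate. *)
have [l lD glw] := coord_neq0 sbf w0; rewrite gD // in glw.
have gyj m : m \in D ->
    (m == j)%:R * (2 * g j (e i)) = g m (e i) - a * g m (e k).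
  move=> mD; rewrite -(gS mD jD) yj gZ // -scaleNr gD //.
  by rewrite mulNr mulrC mulrA divff ?mul1r // mulf_neq0 // pnatr_eq0.
(* Evaluating g_j on y_j shows that g_j vanishes at e_i + a e_k. For l other than j, g_l(y_j) = 0
   gives g_l(e_i) = a g_l(e_k), so neither value is zero. *)
have lj : l != j.
  apply: contra_neqN glw => /eqP ->; have := gyj j jD; rewrite eqxx mul1r; lra.
have := gyj l lD; rewrite (negPf lj) mul0r => /esym/eqP; rewrite subr_eq0 => /eqP glik.
have gli : g l (e i) != 0.
  by apply: contra_neq glw => gli; rewrite -glik gli addr0.
have glk : g l (e k) != 0.
  by apply: contra_neq gli => glk; rewrite glik glk mulr0.
have [m [b [mD b1 yl]]] := preimage_basis_shape iD lD gli.
have [m' [b' [m'D b1' yl']]] := preimage_basis_shape kD lD glk.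
have yl0 : S (f l) != 0 by rewrite -normr_eq0 isoS nf // oner_eq0.
(* The shape of y_l is known from both e_i and e_k. If [m] were not [k], the first form would have
   zero [k]-th coordinate, forcing [m' = k] and [b' = 1] in the second, so y_l = 0. *)
have mk : m = k.
  apply: contraTeq yl0 => mk; rewrite negbK.
  have cE c n n' x : n \in D -> n' \in D ->
      coord d e (c *: (e n - x *: e n')) k = c * ((k == n)%:R - x * (k == n')%:R).
    by move=> nD n'D; rewrite scalerBr scalerA -scaleNr coord2 //; ring.
  have := congr1 (fun x => coord d e x k) yl.
  rewrite {1}yl' !cE // (negPf ki) eqxx [k == m]eq_sym (negPf mk).
  rewrite mulr0 subr0 mulr0 => /eqP; rewrite mulf_eq0 invr_eq0 mulf_eq0 pnatr_eq0.
  rewrite (negPf glk) /= subr_eq0 => /eqP; have [km|_] := eqVneq k m'.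
    by rewrite mulr1 => b'E; rewrite yl' -km -b'E scale1r subrr scaler0.
  by rewrite mulr0 => /eqP; rewrite oner_eq0.
exists l, (2 * g l (e i))^-1; split=> //; rewrite yl mk -scaleNr.
congr (_ *: (_ + _ *: _)).
(* This is g_l(y_l) = 1; together with g_l(e_i) = a g_l(e_k) it yields -b = a. *)
have : 2 * g l (e i) = g l (e i) - b * g l (e k).
  have := gS lD lD; rewrite eqxx yl mk gZ // -scaleNr gD // mulNr => H.
  by rewrite -[LHS]mulr1 -[X in _ * X]H mulrA divff ?mul1r // mulf_neq0 // pnatr_eq0.
move=> H; apply: (mulIf glk); rewrite -glik; lra.
Qed.

Context (s : R) (s0 : s != 0).
Context (cse : two_convexity_sign (d := d) (e := e) s).
Context (csf : two_convexity_sign (d := d) (e := f) s).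

Lemma partner_l22 i k j l (a c c' : R) :
  i \in D -> k \in D -> k != i -> j \in D -> l \in D -> l != j -> `|a| = 1 ->
  S (f j) = c *: (e i - a *: e k) -> S (f l) = c' *: (e i + a *: e k) ->
  ~ (no_l22_subspace X \/ no_l22_subspace Y).
Proof.
move=> iD kD ki jD lD lj a1 yj yl.
set N := `|e i + e k|; set M := `|f j + f l|.
have ik : i != k by rewrite eq_sym.
have NE b : `|b| = 1 -> `|e i + b *: e k| = N.
  move=> b1; rewrite -[e i]scale1r -(norm_abs2 uce _ _ iD kD ik).
  by rewrite b1 normr1 !scale1r.
have cN : `|c| * N = 1.
  by rewrite -(nf jD) -isoS yj normrZ -scaleNr NE // normrN.
have c'N : `|c'| * N = 1 by rewrite -(nf lD) -isoS yl normrZ NE.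
have ME : M = 2 * `|c|.
  have : `|c'| = `|c|.
    have N0 : N != 0 by apply: contra_eq_neq cN => ->; rewrite mulr0 eq_sym oner_eq0.
    by apply: (mulIf N0); rewrite cN.
  (* Since c' = c or c' = -c, the sum y_j + y_l is 2c e_i or -2ca e_k, of norm 2|c| either way. *)
  rewrite /M -isoS linearD yj yl => /eqP; rewrite eqr_norm2 => /orP[]/eqP ->.
    by rewrite -scalerDr addrACA addNr addr0 -mulr2n normrZ normrMn ne // mulrC.
  rewrite scaleNr -scalerBr opprD addrACA subrr add0r -mulr2n normrZ normrMn.
  by rewrite normrN normrZ a1 ne // mul1r mulrC.
have MN : M * N = 2 by rewrite ME -mulrA cN mulr1.
have leN : 0 <= s * (2 - N ^+ 2).
  have := sign_euclid_le uce ne cse 1 1 iD kD ik.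
  by rewrite !scale1r expr1n.
have leM : 0 <= s * (2 - M ^+ 2).
  have := sign_euclid_le ucf nf csf 1 1 jD lD; rewrite eq_sym => /(_ lj).
  by rewrite !scale1r expr1n.
have N2 : N ^+ 2 = 2.
  have M20 : 0 <= M ^+ 2 by rewrite sqr_ge0.
  (* By MN = 2 the two sides agree. The left one is nonnegative and the right one nonpositive, so
     both vanish. *)
  have E : s * (2 - N ^+ 2) * M ^+ 2 = - (2 * (s * (2 - M ^+ 2))).
    by rewrite -mulrA mulrBl -exprMn [N * M]mulrC MN; ring.
  have : s * (2 - N ^+ 2) * M ^+ 2 == 0.
    by rewrite eq_le mulr_ge0 // E oppr_le0 mulr_ge0.
  rewrite mulf_eq0 sqrf_eq0 mulf_eq0 (negPf s0) subr_eq0 => /orP[/eqP <- //|/eqP M0].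
  by move: MN => /eqP; rewrite M0 mul0r eq_sym pnatr_eq0.
have euc a' b' := euclid uce ne cse a' b' s0 iD kD ik N2.
case; first exact: euclid_plane_l22 euc.
(* If it is Y that has no Euclidean plane, the image under [T] of the plane in X gives the
   contradiction. *)
apply: (@euclid_plane_l22 _ _ (T (e i)) (T (e k))) => a' b'.
by rewrite -!linearZ -linearD isoT.
Qed.

Lemma isometry_elementary :
  no_l22_subspace X \/ no_l22_subspace Y -> elementary d e f T.
Proof.
move=> no_l22.
(* A single nonzero coordinate determines T e_i: the case of distinct [k] and [i] is excluded, so
   y_j is a multiple of e_i. *)
have TeE i j : i \in D -> j \in D -> g j (e i) != 0 -> T (e i) = g j (e i) *: f j.
  move=> iD jD gji.
  have [k [a [kD a1 yj]]] := preimage_basis_shape iD jD gji.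
  have [ki|ki] := eqVneq k i; last first.
    have [l [c [lD lj yl]]] := preimage_basis_partner iD jD kD gji ki a1 yj.
    by case: (partner_l22 iD kD ki jD lD lj a1 yj yl no_l22).
  have eE : e i - a *: e i = (1 - a) *: e i by rewrite scalerBl scale1r.
  move: yj; rewrite ki eE scalerA; set c := _ * _ => yj.
  have c1 : c * g j (e i) = 1 by rewrite -gZ // -yj gS // eqxx.
  by rewrite -[f j]SK yj linearZ /= scalerA mulrC c1 scale1r.
have ex i : exists j, i \in D -> j \in D /\ g j (e i) != 0.
  have [iD|_] := boolP (i \in D); last by exists 0%N.
  have [|j jD gji] := coord_neq0 sbf (x := T (e i)); last by exists j.
  by rewrite -normr_eq0 isoT ne // oner_eq0.
pose sigma i := sval (cid (ex i)).
have sigmaP i : i \in D -> sigma i \in D /\ g (sigma i) (e i) != 0.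
  by rewrite /sigma; case: cid.
exists (fun i => g (sigma i) (e i)), sigma; split; first split.
- by move=> i /mem_set/sigmaP[/set_mem].
- move=> i k iD kD sik; have [sD gi] := sigmaP _ iD; have [sD' gk] := sigmaP _ kD.
  move: (TeE _ _ iD sD gi) (TeE _ _ kD sD' gk); rewrite sik.
  set p := g _ (e i); set q := g _ (e k) in gk * => Tei Tek.
  (* If T e_i and T e_k are multiples of the same f_j, this combination lies in the kernel of [T];
     as [q] is nonzero, [i = k]. *)
  have : q *: e i - p *: e k = 0.
    apply: (isometry_inj isoT); rewrite linear0 linearB !linearZ /= Tei Tek.
    by rewrite !scalerN !scalerA [q * p]mulrC subrr.
  rewrite -scaleNr => /(congr1 (fun x => coord d e x i)).
  rewrite coord2 // (coordE sbe expansion0) // eqxx mulr1.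
  have [//|_] := eqVneq i k; rewrite mulr0 addr0 => /eqP.
  by rewrite (negPf gk).
(* T e_i is a multiple of f_j, so its only nonzero coordinate is the [j]-th, and sigma must select
   [j]. *)
- move=> j /mem_set jD; have [i iD gji] := preimage_basis_support jD.
  exists i; first by rewrite -inE.
  have [sD] := sigmaP _ iD; rewrite (TeE _ _ iD jD gji) coordZ // coord_basis //.
  by have [//|_] := eqVneq (sigma i) j; rewrite mulr0 eqxx.
by move=> i iD; have [sD gi] := sigmaP _ iD; apply: TeE.
Qed.

End Reflections.

Theorem corollary5 (R : realType) (X Y : completeNormedModType R)
    (d : option nat) (e : nat -> X) (f : nat -> Y)
    (sepX : separable X) (sepY : separable Y)
    (basis_e : normalized_1unconditional_basis d e)
    (basis_f : normalized_1unconditional_basis d f)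
    (elem : isometries_elementary d e \/ isometries_elementary d f)
    (no_l22 : no_l22_subspace X \/ no_l22_subspace Y)
    (cvx : (one_2_convex d e /\ one_2_convex d f) \/
           (one_2_concave d e /\ one_2_concave d f))
    (T : {linear X -> Y}) (isoT : surjective_isometry T) :
  elementary d e f T.
Proof.
have [sbe _ _] := basis_e; have [sbf _ nf] := basis_f.
have [s [s0 cse csf]] : exists s : R, [/\ s != 0,
    two_convexity_sign (d := d) (e := e) s & two_convexity_sign (d := d) (e := f) s].
  case: cvx => -[ce cf]; [exists 1 | exists (-1)]; split.
  - exact: oner_neq0.
  - exact: convex_sign.
  - exact: convex_sign.
  - by rewrite oppr_eq0 oner_neq0.
  - exact: concave_sign.
  - exact: concave_sign.
have [S [isoS SK TK]] := surjective_isometry_inverse isoT.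
case: elem => [eleme|elemf].
  exact: (isometry_elementary basis_e basis_f eleme isoT.1 SK TK s0 cse csf no_l22).
(* When the elementary isometries are those of Y, the argument is run for the inverse [S] and the
   result inverted. *)
apply: (elementary_inverse _ SK) => [i iD|].
  by rewrite -normr_eq0 nf // oner_eq0.
have no_l22' : no_l22_subspace Y \/ no_l22_subspace X by case: no_l22; [right | left].
exact: (isometry_elementary basis_f basis_e elemf isoS.1 TK SK s0 csf cse no_l22').
Qed.
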